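(* When $P(f)$ is continuous (with respect to $\|f\|$), then for every Lebesgue measurable set $E\subset[0,1]$, $$P\bigl(c(E;x)\bigr)=(D;G_2)\int_E g(I)=g(E),$$ where $g(E)$ is the Lebesgue extension of $g(I)$.
   Context: $W=[0,1]$. For $n\ge1$ and $N=2^{n-1}$ put $I_{jn}=\left[\frac{j-1}{N},\frac{j}{N}\right)$ for $j=1,\dots,N$, and let $D_n$ be the division of $W$ into $I_{1n},\dots,I_{Nn}$; $G_2$ is the set of the divisions $D_n$ ($n=1,2,\dots$). $K$ is a (finitely) additive family (an algebra) of Lebesgue measurable subsets of $W$ containing all the $I_{jn}$, and $g:K\to\mathbb R$ satisfies $g(E_1)+g(E_2)=g(E_1+E_2)$ for disjoint $E_1,E_2\in K$. $c(E;x)$ denotes the characteristic function of $E$. For $f(x)=\sum_{i=1}^n b_ic(E_i;x)$, with real $b_i$ and disjoint non-empty $E_i\in K$, put $P(f)=\sum_{i=1}^n b_ig(E_i)$. $\|f\|=\left(\int_0^1|f(x)|^2dx\right)^{1/2}$. $P$ is called continuous if $P(f_n)\to P(f)$ whenever $\|f-f_n\|\to0$, equivalently if there is $M$ with $|P(f)|\le M\|f\|$ for all such $f$; $P$ then denotes also its unique continuous extension to the real space $L^2(0,1)$. The density integral with respect to $G_2$ is $$(D;G_2)\int_E g(I)=\lim_{n\to\infty}\sum_{j=1}^{N}\frac{g(I_{jn})\,m(E\cap I_{jn})}{m(I_{jn})},$$ where $m$ is Lebesgue measure (the claim includes the existence of this limit). When $P$ is continuous, $g$ is additive and absolutely continuous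 on the dyadic intervals $I_{jn}$; its Lebesgue extension is the set function $g(E)=\int_E g'(x)\,dx$, where $g'$ is the a.e. derivative of $g(I)$, i.e. the unique absolutely continuous, countably additive set function on the measurable subsets of $[0,1]$ which agrees with $g$ on all the $I_{jn}$. *)

(* Defs.v *)
From HB Require Import structures.
From mathcomp Require Import all_boot all_order all_algebra.
From mathcomp Require Import all_classical all_reals all_analysis.

Set Implicit Arguments.
Unset Strict Implicit.
Unset Printing Implicit Defensive.

Import Order.TTheory GRing.Theory Num.Theory.
Import numFieldNormedType.Exports.

Local Open Scope classical_set_scope.
Local Open Scope ring_scope.

(* The carrier of [completed_lebesgue_measure]: it is convertible to [R], but
   its measurable sets are the Lebesgue measurable sets (Caratheodory's
   condition), whereas those of [R] itself are only the Borel sets. *)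
Notation lebesgueType R :=
  (caratheodory_type (T := ocitv_type R) ((wlength (@idfun R))^*)%mu)
  (only parsing).

Definition leb {R : realType} : {measure set (lebesgueType R) -> \bar R} :=
  @completed_lebesgue_measure R.

Definition lebesgue_measurable {R : realType} (A : set R) : Prop :=
  measurable (A : set (lebesgueType R)).

Definition W {R : realType} : set R := [set` `[0%R, 1%R]].

Lemma lebesgue_measurable_W (R : realType) : lebesgue_measurable (@W R).
Proof.
apply: sub_caratheodory; exact: (@measurable_itv R `[0%R, 1%R]).
Qed.

Definition lebW {R : realType} : {measure set (lebesgueType R) -> \bar R} :=
  mrestr leb (@lebesgue_measurable_W R).

(* L^2(0,1) and its norm (\int_0^1 |f|^2)^(1/2); functions are defined
   on R, but [lebW] ignores their values outside [W]. *)
Definition L2 {R : realType} : {pred R -> R} := Lfun (@lebW R) 2%:E.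
Definition L2norm {R : realType} (f : R -> R) : \bar R :=
  'N[@lebW R]_(2%:E)[EFin \o f].

(* Indices are shifted to start at 0: these are the intervals I_{j+1,n+1},
   0 <= j < 2^n, of the division D_{n+1}. *)
Definition dyadic {R : realType} (n j : nat) : set R :=
  [set` `[j%:R / 2 ^+ n, j.+1%:R / 2 ^+ n[].

Definition algebra_on {T : Type} (D : set T) (K : set (set T)) : Prop :=
  [/\ (forall A, K A -> A `<=` D), K D & setring K].

Definition additive_on {R : realType} (K : set (set R)) (g : set R -> R) :
    Prop :=
  forall A B, K A -> K B -> A `&` B = set0 -> g A + g B = g (A `|` B).

(* A representation \sum_i b_i c(E_i; x) with disjoint non-empty E_i in K; P is
   defined on representations, so that its value is not assumed to depend on
   the represented function only. *)
Record step {R : realType} (K : set (set R)) := Step {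
  step_size : nat;
  step_coef : 'I_step_size.+1 -> R;
  step_set : 'I_step_size.+1 -> set R;
  step_setK : forall i, K (step_set i);
  step_set_neq0 : forall i, step_set i !=set0;
  step_trivIset : trivIset [set: 'I_step_size.+1] step_set }.
Arguments step_size {R K} s.
Arguments step_coef {R K} s i.
Arguments step_set {R K} s i.

Definition step_fun {R : realType} {K : set (set R)} (s : step K) (x : R) : R :=
  \sum_i step_coef s i * \1_(step_set s i) x.

Definition P {R : realType} {K : set (set R)} (g : set R -> R) (s : step K) :
    R :=
  \sum_i step_coef s i * g (step_set s i).

Definition P_continuous {R : realType} (K : set (set R)) (g : set R -> R) :
    Prop :=
  forall (s_ : nat -> step K) (s : step K),
    L2norm (step_fun s \- step_fun (s_ n)) @[n --> \oo] --> 0%E ->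
    P g (s_ n) @[n --> \oo] --> P g s.

(* Q is the continuous extension of P to L^2(0,1). *)
Definition L2_extension {R : realType} (K : set (set R)) (g : set R -> R)
    (Q : (R -> R) -> R) : Prop :=
  (forall s : step K, Q (step_fun s) = P g s) /\
  (forall (f_ : nat -> R -> R) (f : R -> R),
    (forall n, f_ n \in L2) -> f \in L2 ->
    L2norm (f \- f_ n) @[n --> \oo] --> 0%E ->
    Q (f_ n) @[n --> \oo] --> Q f).

Definition density_sum {R : realType} (g : set R -> R) (E : set R) (n : nat) :
    R :=
  \sum_(j < 2 ^ n)
    g (dyadic n j) * fine (leb (E `&` dyadic n j)) / fine (leb (dyadic n j)).

Definition density_integral {R : realType} (g : set R -> R) (E : set R) : R :=
  limn (density_sum g E).

(* G is an absolutely continuous, countably additive set function on the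
   Lebesgue measurable subsets of W which agrees with g on the dyadic
   intervals; its values on other sets are irrelevant. *)
Definition lebesgue_extension {R : realType} (g G : set R -> R) : Prop :=
  [/\ forall n (j : 'I_(2 ^ n)), G (dyadic n j) = g (dyadic n j),
      forall F : nat -> set R,
        (forall i, lebesgue_measurable (F i) /\ F i `<=` W) ->
        trivIset [set: nat] F ->
        \sum_(0 <= i < n) G (F i) @[n --> \oo] --> G (\bigcup_i F i) &
      forall e : R, 0 < e -> exists2 d : R, 0 < d &
        forall A, lebesgue_measurable A -> A `<=` W ->
          (leb A < d%:E)%E -> `|G A| < e ].

(* dg is the a.e. derivative of the function of dyadic intervals g: for almost
   all x, g(I) / m(I) tends to dg x along the dyadic intervals I containing x. *)
Definition ae_derivative {R : realType} (g : set R -> R) (dg : R -> R) : Prop :=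
  {ae @lebW R, forall x : R, forall j : forall n, 'I_(2 ^ n),
    (forall n, dyadic n (j n) x) ->
    g (dyadic n (j n)) / fine (leb (dyadic n (j n))) @[n --> \oo] --> dg x}.

(* Main.v *)
Require Import Defs.
From HB Require Import structures.
From mathcomp Require Import all_boot all_order all_algebra.
From mathcomp Require Import all_classical all_reals all_analysis.
From mathcomp Require Import measurable_realfun lra.
Import Order.TTheory GRing.Theory Num.Theory.
Import numFieldNormedType.Exports.
Local Open Scope classical_set_scope.
Local Open Scope ring_scope.

(** The value of the n-th density sum is P of the step function E_n which on each
dyadic interval of rank n is constantly the mean value of c(E; x) on that
interval. By the Lebesgue differentiation theorem E_n tends to c(E; x) almost
everywhere, hence in L^2 by dominated convergence ([average_cvg_L2]). So, as
soon as P is continuous, every continuous extension of P sends c(E; x) to the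
density integral of g over E.

Continuity yields a bound |P(f)|^2 <= M ||f||^2 on the dyadic step functions
([dyadic_sum_bound]), which makes the density sums of every Lebesgue measurable
set a Cauchy sequence ([is_cvg_density_sum]) and gives the estimate
|D(E)|^2 <= M m(E) for the density integral D(E). The set function D is additive
like the density sums, the estimate makes it absolutely continuous and countably
additive, and it coincides with g on the whole of K, since P itself is continuous
at c(E; x) for E in K: D is a Lebesgue extension of g
([lebesgue_extension_density_integral]).

Any Lebesgue extension G of g has, by the Radon-Nikodym theorem, an integrable
density h, and h is almost everywhere the limit of g(I) / m(I) along the dyadic
intervals I that shrink to a point ([lebesgue_extension_derivative]). As this
limit only involves g, two Lebesgue extensions have almost everywhere the same
density and are equal, so that the density integral is the Lebesgue extension.

The continuous extension of P is f |-> \int f h, where h is the density of D.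
It is defined and continuous on L^2 because h itself is square integrable: the
step functions h_n with value g(I) / m(I) on each interval I of rank n satisfy
||h_n||^2 = P(h_n), whence ||h_n||^2 <= M, and Fatou's lemma passes this bound
to their limit h ([derivative_L2]). *)

Set Implicit Arguments.
Unset Strict Implicit.
Unset Printing Implicit Defensive.

(** * Dyadic step functions *)

(** The index j for which x belongs to [dyadic n j], when 0 <= x. *)
Definition cell {R : realType} (n : nat) (x : R) : nat :=
  Num.truncn (x * 2 ^+ n).

(** A step function is recorded by its coefficients c alone, indexed by nat so that
refining a division amounts to composing c with a division by a power of 2. *)
Definition dyadic_fun {R : realType} (n : nat) (c : nat -> R) (x : R) : R :=
  if 0 <= x < 1 then c (cell n x) else 0.

(** The functional P on the step function [dyadic_fun n c]. *)
Definition dyadic_sum {R : realType} (g : set R -> R) (n : nat)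
    (c : nat -> R) : R :=
  \sum_(j < 2 ^ n) c j * g (dyadic n j).

(** The square of the L^2 norm of [dyadic_fun n c]. *)
Definition dyadic_norm2 {R : realType} (n : nat) (c : nat -> R) : R :=
  \sum_(j < 2 ^ n) c j ^+ 2 / 2 ^+ n.

Definition average {R : realType} (E : set R) (n j : nat) : R :=
  fine (leb (E `&` dyadic n j)) / fine (leb (dyadic n j)).

Lemma dyadicP (R : realType) n j (x : R) :
  dyadic n j x <-> 0 <= x /\ cell n x = j.
Proof.
have p0 : (0 : R) < 2 ^+ n by rewrite exprn_gt0.
rewrite /dyadic/= in_itv/= ler_pdivrMr// ltr_pdivlMr//; split.
- move=> /[dup] xj /andP[xj1 _]; split.
    by rewrite -(pmulr_lge0 _ p0) (le_trans _ xj1).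
  exact: truncn_def.
- by move=> [x0 <-]; apply: truncn_itv; rewrite mulr_ge0// ltW.
Qed.

Lemma cell_ltn (R : realType) n (x : R) : 0 <= x < 1 -> (cell n x < 2 ^ n)%N.
Proof.
move=> /andP[x0 x1].
have p0 : (0 : R) < 2 ^+ n by rewrite exprn_gt0.
have /andP[cx _] : (cell n x)%:R <= x * 2 ^+ n < (cell n x).+1%:R.
  by apply: truncn_itv; rewrite mulr_ge0// ltW.
rewrite -(ltr_nat R) (le_lt_trans cx)// natrX.
by rewrite -[ltRHS]mul1r ltr_pM2r.
Qed.

Lemma divn_cell (R : realType) n m (x : R) : (n <= m)%N -> 0 <= x ->
  (cell m x %/ 2 ^ (m - n))%N = cell n x.
Proof.
move=> nm x0.
have p0 k : (0 : R) < 2 ^+ k by rewrite exprn_gt0.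
have q0 : (0 < 2 ^ (m - n))%N by rewrite expn_gt0.
have /andP[cx1 cx2] : (cell m x)%:R <= x * 2 ^+ m < (cell m x).+1%:R.
  by apply: truncn_itv; rewrite mulr_ge0// ltW.
have e : (2 ^+ m : R) = 2 ^+ n * (2 ^ (m - n))%:R.
  by rewrite natrX -exprD subnKC.
have Q0 : (0 : R) < (2 ^ (m - n))%:R by rewrite ltr0n.
apply/esym/truncn_def; rewrite -(ler_pM2r Q0) -(ltr_pM2r Q0) -mulrA -e.
rewrite -!natrM (le_trans _ cx1) ?ler_nat ?leq_divM//=.
by rewrite (lt_le_trans cx2)// ler_nat -ltn_divLR.
Qed.

Lemma dyadic_ge0_lt1 (R : realType) n j (x : R) : (j < 2 ^ n)%N ->
  dyadic n j x -> 0 <= x < 1.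
Proof.
have p0 : (0 : R) < 2 ^+ n by rewrite exprn_gt0.
move=> jn; rewrite /dyadic/= in_itv/= => /andP[jx xj]; apply/andP; split.
  by rewrite (le_trans _ jx)// divr_ge0// ltW.
by rewrite (lt_le_trans xj)// ler_pdivrMr// mul1r -natrX ler_nat.
Qed.

Lemma dyadic_subW (R : realType) n j : (j < 2 ^ n)%N ->
  dyadic n j `<=` (@W R).
Proof.
move=> jn x /(dyadic_ge0_lt1 jn) /andP[x0 x1].
by rewrite /W/= in_itv/= x0 ltW.
Qed.

Lemma dyadic_neq0 (R : realType) n j : @dyadic R n j !=set0.
Proof.
exists (j%:R / 2 ^+ n); rewrite /dyadic/= in_itv/= lexx/=.
by rewrite ltr_pM2r ?invr_gt0 ?exprn_gt0// ltr_nat.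
Qed.

Lemma trivIset_dyadic (R : realType) n (D : set nat) :
  trivIset D (@dyadic R n).
Proof.
apply/trivIsetP => i j _ _ /eqP ij; apply/seteqP; split => // x [].
by rewrite !dyadicP => -[_ xi] [_ xj]; exact: ij (etrans (esym xi) xj).
Qed.

Lemma measurable_dyadic (R : realType) n j :
  measurable (@dyadic R n j : set R).
Proof. exact: measurable_itv. Qed.

Lemma lebesgue_measurable_borel (R : realType) (A : set R) :
  measurable A -> lebesgue_measurable A.
Proof. by move=> mA; exact: sub_caratheodory. Qed.

Lemma lebesgue_measurable_dyadic (R : realType) n j :
  lebesgue_measurable (@dyadic R n j).
Proof. by apply: lebesgue_measurable_borel; exact: measurable_dyadic. Qed.

(** Both measures are the restriction of the same outer measure. *)
Lemma leb_borel (R : realType) (A : set R) : leb A = lebesgue_measure A.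
Proof. by []. Qed.

Lemma leb_dyadic (R : realType) n j : leb (@dyadic R n j) = (2 ^- n)%:E.
Proof.
have p0 : (0 : R) < 2 ^+ n by rewrite exprn_gt0.
rewrite leb_borel lebesgue_measure_itv/= lte_fin ltr_pM2r ?invr_gt0// ltr_nat.
rewrite ltnSn -EFinD; congr EFin.
by rewrite -mulrBl -natrB// subSnn mul1r.
Qed.

Lemma lebW_dyadic (R : realType) n j : (j < 2 ^ n)%N ->
  lebW (@dyadic R n j) = (2 ^- n)%:E.
Proof.
move=> jn; rewrite -(@leb_dyadic R n j) /lebW/= /mrestr setIidl//.
exact: dyadic_subW.
Qed.

Lemma leb_W (R : realType) : leb (@W R) = 1%E.
Proof.
by rewrite leb_borel /W lebesgue_measure_itv/= lte_fin ltr01 oppr0 adde0.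
Qed.

Lemma lebW_setT (R : realType) : lebW [set: lebesgueType R] = 1%E.
Proof. by rewrite /lebW/= /mrestr setTI leb_W. Qed.

Lemma dyadic_funE (R : realType) n (c : nat -> R) (x : R) :
  dyadic_fun n c x = \sum_(j < 2 ^ n) c j * \1_(dyadic n j) x.
Proof.
rewrite /dyadic_fun; case: ifPn => [x01|x01].
- rewrite (bigD1 (Ordinal (cell_ltn n x01)))//= indicE mem_set ?mulr1; last first.
    by apply/dyadicP; split => //; case/andP : x01.
  rewrite big1 ?addr0// => i; rewrite -val_eqE/= => ij.
  rewrite indicE memNset ?mulr0// => /dyadicP[_ xi].
  by rewrite xi eqxx in ij.
- rewrite big1// => i _; rewrite indicE memNset ?mulr0//.
  by move=> /(dyadic_ge0_lt1 (ltn_ord i)); apply/negP.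
Qed.

Lemma measurable_dyadic_fun (R : realType) n (c : nat -> R) :
  measurable_fun [set: lebesgueType R] (dyadic_fun n c).
Proof.
rewrite (_ : dyadic_fun n c =
  fun x => \sum_(j < 2 ^ n) c j * \1_(dyadic n j) x); last first.
  by apply/funext => x; exact: dyadic_funE.
apply: measurable_sum => j; apply: measurable_funM => //.
by apply: measurable_indic; exact: lebesgue_measurable_dyadic.
Qed.

Lemma refine_dyadic_fun (R : realType) n m (c : nat -> R) : (n <= m)%N ->
  dyadic_fun n c = dyadic_fun m (fun j => c (j %/ 2 ^ (m - n))%N).
Proof.
move=> nm; apply/funext => x; rewrite /dyadic_fun; case: ifPn => // /andP[x0 _].
by rewrite divn_cell.
Qed.

Lemma dyadic_funB (R : realType) n (c d : nat -> R) :
  dyadic_fun n c \- dyadic_fun n d = dyadic_fun n (fun j => c j - d j).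
Proof.
by apply/funext => x; rewrite /dyadic_fun/=; case: ifPn; rewrite ?subr0.
Qed.

Lemma average_ge0 (R : realType) (E : set R) n j : 0 <= average E n j.
Proof. by rewrite /average divr_ge0// fine_ge0// measure_ge0. Qed.

Lemma leb_setI_dyadic_fin (R : realType) (E : set R) n j :
  lebesgue_measurable E -> leb (E `&` dyadic n j) \is a fin_num.
Proof.
move=> mE; rewrite ge0_fin_numE ?measure_ge0//.
apply: (@le_lt_trans _ _ (leb (@dyadic R n j))); last by rewrite leb_dyadic ltry.
apply: le_measure; rewrite ?inE.
- by apply: measurableI => //; exact: lebesgue_measurable_dyadic.
- exact: lebesgue_measurable_dyadic.
- exact: subIsetr.
Qed.

Lemma average_le1 (R : realType) (E : set R) n j :
  lebesgue_measurable E -> average E n j <= 1.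
Proof.
move=> mE; rewrite /average leb_dyadic/= ler_pdivrMr ?invr_gt0 ?exprn_gt0//.
rewrite mul1r -lee_fin fineK ?leb_setI_dyadic_fin// -(@leb_dyadic _ n j).
apply: le_measure; rewrite ?inE.
- by apply: measurableI => //; exact: lebesgue_measurable_dyadic.
- exact: lebesgue_measurable_dyadic.
- exact: subIsetr.
Qed.

Lemma density_sumE (R : realType) (g : set R -> R) E n :
  density_sum g E n = dyadic_sum g n (average E n).
Proof.
rewrite /density_sum /dyadic_sum; apply: eq_bigr => j _.
by rewrite /average [RHS]mulrC mulrA.
Qed.

(** * The norm of L^2(0,1) *)

Lemma L2normE (R : realType) (f : R -> R) (r : R) : 0 <= r ->
  (\int[@lebW R]_x (f x ^+ 2)%:E = r%:E)%E -> L2norm f = (Num.sqrt r)%:E.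
Proof.
move=> r0 fr; rewrite /L2norm unlock /=.
under eq_integral do rewrite powR_mulrn// real_normK ?num_real//.
by rewrite fr poweR_EFin powR12_sqrt.
Qed.

Lemma L2norm_cvg0 (R : realType) (f_ : nat -> R -> R) (r_ : nat -> R) :
  (forall n, 0 <= r_ n) ->
  (forall n, (\int[@lebW R]_x (f_ n x ^+ 2)%:E = (r_ n)%:E)%E) ->
  r_ n @[n --> \oo] --> 0 -> L2norm (f_ n) @[n --> \oo] --> 0%E.
Proof.
move=> r0 fr rcvg.
rewrite (_ : (fun n => _) = EFin \o (fun n => Num.sqrt (r_ n))); last first.
  by apply/funext => n /=; exact: L2normE.
apply: cvg_EFin; first exact: nearW.
rewrite -[X in _ --> X]sqrtr0.
by apply: (continuous_cvg _ _ rcvg); exact: sqrt_continuous.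
Qed.

Lemma L2normB (R : realType) (f g : R -> R) :
  L2norm (f \- g) = L2norm (g \- f).
Proof.
rewrite /L2norm -oppe_Lnorm; apply: eq_Lnorm => x /=.
by rewrite opprB.
Qed.

Lemma L2norm_triangle (R : realType) (f g h : R -> R) :
  measurable_fun [set: lebesgueType R] f ->
  measurable_fun [set: lebesgueType R] g ->
  measurable_fun [set: lebesgueType R] h ->
  (L2norm (f \- h)%R <= L2norm (f \- g)%R + L2norm (g \- h)%R)%E.
Proof.
move=> mf mg mh.
rewrite (_ : f \- h = (f \- g) \+ (g \- h)); last first.
  by apply/funext => x /=; rewrite addrA subrK.
have le12 : 1 <= 2 :> R by rewrite ler1n.
exact: (@minkowski_EFin _ _ _ (@lebW R) (f \- g) (g \- h) 2
  (measurable_funB mf mg) (measurable_funB mg mh) le12).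
Qed.

Lemma near_lt_cvg0 (R : realType) (u : nat -> \bar R) (e : R) : 0 < e ->
  u n @[n --> \oo] --> 0%E -> \forall n \near \oo, (u n < e%:E)%E.
Proof.
move=> e0 /fine_cvgP[ufin u0].
apply: filterS2 ufin (cvgr_lt _ u0 _ e0) => n un une.
by rewrite -(fineK un) lte_fin.
Qed.

Lemma integral_dyadic_fun_sqr (R : realType) n (c : nat -> R) :
  (\int[lebW]_x (dyadic_fun n c x ^+ 2)%:E = (dyadic_norm2 n c)%:E)%E.
Proof.
transitivity (\int[@lebW R]_x
    \sum_(j < 2 ^ n) ((c j ^+ 2)%:E * (\1_(dyadic n j) x)%:E))%E.
  apply: eq_integral => x _.
  transitivity ((dyadic_fun n (fun j => c j ^+ 2) x)%:E).
    by rewrite /dyadic_fun; case: ifPn => //; rewrite expr0n.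
  by rewrite dyadic_funE -sumEFin.
have mD j : measurable (dyadic n j : set (lebesgueType R)).
  exact: lebesgue_measurable_dyadic.
have m1 j : measurable_fun [set: lebesgueType R]
    (fun x => (\1_(dyadic n j) x : R)%:E).
  by apply/measurable_EFinP; exact: measurable_indic.
have c0 j : (0 <= (c j ^+ 2)%:E)%E by rewrite lee_fin sqr_ge0.
have i0 j (x : R) : (0 <= (\1_(dyadic n j) x : R)%:E)%E by rewrite lee_fin.
rewrite (@ge0_integral_sum _ (lebesgueType R) R lebW setT measurableT 'I_(2 ^ n)
  (fun j x => (c j ^+ 2)%:E * (\1_(dyadic n j) x)%:E)%E
  (fun j => measurable_funeM _ (m1 j)) (fun j x _ => mule_ge0 (c0 j) (i0 j x))).
rewrite /dyadic_norm2 -sumEFin; apply: eq_bigr => j _.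
rewrite (@ge0_integralZl _ (lebesgueType R) R lebW setT measurableT _ (m1 j)
  _ (fun x _ => i0 j x) (c0 j)).
by rewrite integral_indic// setIT EFinM (@lebW_dyadic R n j).
Qed.

Lemma dyadic_norm2_ge0 (R : realType) n (c : nat -> R) : 0 <= dyadic_norm2 n c.
Proof.
by apply: sumr_ge0 => j _; rewrite divr_ge0 ?sqr_ge0.
Qed.

Lemma L2norm_dyadic_fun (R : realType) n (c : nat -> R) :
  L2norm (dyadic_fun n c) = (Num.sqrt (dyadic_norm2 n c))%:E.
Proof. exact: L2normE (dyadic_norm2_ge0 _ _) (integral_dyadic_fun_sqr _ _). Qed.

Lemma mem_L2 (R : realType) (f : R -> R) :
  measurable_fun [set: lebesgueType R] f -> (L2norm f < +oo)%E -> f \in L2.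
Proof.
by move=> mf ffin; apply/andP; split; rewrite inE.
Qed.

Lemma dyadic_fun_L2 (R : realType) n (c : nat -> R) : dyadic_fun n c \in L2.
Proof.
apply: mem_L2; first exact: measurable_dyadic_fun.
by rewrite L2norm_dyadic_fun ltry.
Qed.

Lemma lebW_fin (R : realType) (E : set R) : lebesgue_measurable E ->
  lebW E \is a fin_num.
Proof.
move=> mE; rewrite ge0_fin_numE ?measure_ge0//.
rewrite (@le_lt_trans _ _ (lebW [set: lebesgueType R]))//.
  by apply: le_measure; rewrite ?inE.
by rewrite lebW_setT ltry.
Qed.

Lemma measurable_fun_indic_lebesgue (R : realType) (E : set R) :
  lebesgue_measurable E ->
  measurable_fun [set: lebesgueType R] (\1_E : R -> R).
Proof. exact: measurable_indic. Qed.

Lemma indic_L2 (R : realType) (E : set R) : lebesgue_measurable E ->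
  (\1_E : R -> R) \in L2.
Proof.
move=> mE; apply: mem_L2; first exact: measurable_fun_indic_lebesgue.
have Efin := lebW_fin mE.
rewrite (@L2normE _ _ (fine (lebW E))) ?ltry ?fine_ge0 ?measure_ge0// fineK//.
transitivity (\int[@lebW R]_x (\1_E x)%:E)%E.
  by apply: eq_integral => x _; rewrite indicE; case: (_ \in _);
    rewrite ?expr1n ?expr0n.
by rewrite integral_indic// setIT.
Qed.

Lemma integrable_cst_lebW (R : realType) (r : R) :
  (@lebW R).-integrable [set: lebesgueType R] (cst r%:E).
Proof.
apply/integrableP; split; first exact: measurable_cst.
under eq_integral do rewrite /=.
by rewrite integral_cst// lebW_setT mule1 ltry.
Qed.

(** * A continuous functional is bounded on dyadic step functions *)

(** The type of steps has size n.+1, whence the predecessor of 2 ^ n. *)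
Lemma sum_pred2 (V : nmodType) n (F : nat -> V) :
  \sum_(i < (2 ^ n).-1.+1) F i = \sum_(i < 2 ^ n) F i.
Proof.
by rewrite -(big_mkord xpredT F) -(big_mkord xpredT F) prednK// expn_gt0.
Qed.

Section continuous_functional.
Context {R : realType} (K : set (set R)) (g : set R -> R).
Hypothesis KD : forall n (j : 'I_(2 ^ n)), K (dyadic n j).

Lemma dyadic_stepK n (i : 'I_(2 ^ n).-1.+1) : K (dyadic n i).
Proof.
have i2n : (i < 2 ^ n)%N.
  by rewrite (leq_trans (ltn_ord i))// prednK ?expn_gt0.
exact: (KD (Ordinal i2n)).
Qed.

Lemma trivIset_dyadic_ord n :
  trivIset [set: 'I_(2 ^ n).-1.+1] (fun i => @dyadic R n i).
Proof.
have /trivIsetP tD := @trivIset_dyadic R n setT.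
apply/trivIsetP => i j _ _ ij; exact: tD.
Qed.

Definition dyadic_step n (c : nat -> R) : step K :=
  @Step R K (2 ^ n).-1 (fun i => c i) (fun i => dyadic n i)
    (@dyadic_stepK n) (fun i => @dyadic_neq0 R n i) (@trivIset_dyadic_ord n).

Lemma step_fun_dyadic n c : step_fun (dyadic_step n c) = dyadic_fun n c.
Proof.
apply/funext => x; rewrite dyadic_funE /step_fun/=.
exact: (sum_pred2 n (fun j => c j * \1_(dyadic n j) x)).
Qed.

Lemma P_dyadic n c : P g (dyadic_step n c) = dyadic_sum g n c.
Proof. exact: (sum_pred2 n (fun j => c j * g (dyadic n j))). Qed.

Hypothesis Pc : P_continuous K g.

(** A constant sequence of representations of one function converges in norm to any
other representation of that function. *)
Lemma P_step_fun_eq (s t : step K) : step_fun s = step_fun t -> P g s = P g t.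
Proof.
move=> st; apply: (@cvg_unique _ _ (P g s @[n --> \oo])); last 2 first.
- exact: cvg_cst.
- apply: Pc; rewrite st.
  apply: (@L2norm_cvg0 _ _ (fun=> 0)) => //; last exact: cvg_cst.
  move=> _; under eq_integral do rewrite /= subrr expr0n.
  exact: integral0.
- exact: norm_hausdorff.
Qed.

Lemma refine_dyadic_sum n m (c : nat -> R) : (n <= m)%N ->
  dyadic_sum g n c = dyadic_sum g m (fun j => c (j %/ 2 ^ (m - n))%N).
Proof.
move=> nm; rewrite -!P_dyadic; apply: P_step_fun_eq.
by rewrite !step_fun_dyadic; exact: refine_dyadic_fun.
Qed.

(** This is the usual argument for a functional which is continuous at 0, in terms
of squares: P is homogeneous on step functions of a given rank, so violations of
the bound for larger and larger constants can be rescaled. *)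
Lemma dyadic_sum_bound : exists2 M : R, 0 <= M &
  forall n c, dyadic_sum g n c ^+ 2 <= M * dyadic_norm2 n c.
Proof.
apply: contrapT => noM.
have big (k : nat) : exists nc : nat * (nat -> R),
    k.+1%:R * dyadic_norm2 nc.1 nc.2 < dyadic_sum g nc.1 nc.2 ^+ 2.
  apply: contrapT => H; apply: noM; exists k.+1%:R => // n c.
  rewrite leNgt; apply/negP => nc; apply: H; exists (n, c).
  exact: nc.
have [nc ncP] := choice big.
(* P takes the value 1 on the normalized violations of the bound, although
   their norms tend to 0. *)
pose D k := dyadic_sum g (nc k).1 (nc k).2.
have D0 k : D k != 0.
  rewrite -sqrf_eq0 gt_eqF// (le_lt_trans _ (ncP k))// mulr_ge0//.
  exact: dyadic_norm2_ge0.
pose c k j : R := (nc k).2 j / D k.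
have sumc k : dyadic_sum g (nc k).1 (c k) = 1.
  rewrite /dyadic_sum; under eq_bigr do rewrite /c mulrAC.
  by rewrite -mulr_suml divff// D0.
have normc k : dyadic_norm2 (nc k).1 (c k) <= k.+1%:R^-1.
  rewrite (_ : dyadic_norm2 _ _ = dyadic_norm2 (nc k).1 (nc k).2 / D k ^+ 2).
    have D20 : 0 < D k ^+ 2 by rewrite lt0r sqrf_eq0 D0 sqr_ge0.
    by rewrite ler_pdivrMr// ler_pdivlMl// ltW.
  rewrite /dyadic_norm2 mulr_suml; apply: eq_bigr => j _.
  by rewrite /c exprMn exprVn mulrAC.
have := @Pc (fun k => dyadic_step (nc k).1 (c k)) (dyadic_step 0 (cst 0)).
rewrite (_ : P g (dyadic_step 0 (cst 0)) = 0); last first.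
  by rewrite P_dyadic /dyadic_sum big1// => j _; rewrite mul0r.
have -> : (fun k => P g (dyadic_step (nc k).1 (c k))) = cst 1.
  by apply/funext => k; rewrite P_dyadic sumc.
move=> H.
suff /H : L2norm (step_fun (dyadic_step 0 (cst 0)) \-
    step_fun (dyadic_step (nc k).1 (c k))) @[k --> \oo] --> 0%E.
  move/cvg_lim; rewrite lim_cst// => /(_ (@norm_hausdorff _ _))/eqP.
  by rewrite oner_eq0.
apply: (@L2norm_cvg0 _ _ (fun k => dyadic_norm2 (nc k).1 (c k))).
- by move=> k; exact: dyadic_norm2_ge0.
- move=> k; rewrite -integral_dyadic_fun_sqr; apply: eq_integral => x _.
  rewrite !step_fun_dyadic /=; congr EFin.
  by rewrite {1}/dyadic_fun if_same sub0r sqrrN.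
- apply: (@squeeze_cvgr _ _ _ _ (cst 0) (fun k => k.+1%:R^-1)).
  + by apply: nearW => k; rewrite dyadic_norm2_ge0 normc.
  + exact: cvg_cst.
  + exact: cvg_harmonic.
Qed.

End continuous_functional.

(** * Lebesgue measurable sets and Borel sets *)

Lemma lebW_le_leb (R : realType) (A : set R) : lebesgue_measurable A ->
  (lebW A <= leb A)%E.
Proof.
move=> mA; rewrite /lebW/= /mrestr; apply: le_measure; rewrite ?inE//.
by apply: measurableI => //; exact: lebesgue_measurable_W.
Qed.

Lemma lebWE (R : realType) (A : set R) : A `<=` W -> lebW A = leb A.
Proof. by move=> AW; rewrite /lebW/= /mrestr setIidl. Qed.

Lemma ae_lebW (R : realType) (Q : R -> Prop) :
  {ae @lebesgue_measure R, forall x, Q x} -> {ae @lebW R, forall x, Q x}.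
Proof.
move=> [N [mN N0 QN]]; exists N; split => //; first exact: sub_caratheodory.
apply/eqP; rewrite eq_le measure_ge0 andbT -N0; apply: lebW_le_leb.
exact: sub_caratheodory.
Qed.

Lemma ae_lebW_itv (R : realType) : {ae @lebW R, forall x : R, 0 <= x < 1}.
Proof.
exists (~` `[0, 1[%classic); split => //.
- by apply: measurableC; apply: sub_caratheodory; exact: measurable_itv.
- rewrite /lebW/= /mrestr (_ : _ `&` _ = [set 1]); last first.
    apply/seteqP; split => x /=; rewrite /W/= !in_itv/=.
    + move=> [/negP]; rewrite negb_and -!ltNge -leNgt => /orP[x0|x1].
        by rewrite leNgt x0.
      by move=> /andP[_ x1']; apply/eqP; rewrite eq_le x1 x1'.
    + by move=> ->; rewrite ltxx ler01 lexx andbF; split.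
  exact: lebesgue_measure_set1.
Qed.

Lemma measurable_fun_borel (R : realType) d (T : measurableType d)
    (f : R -> T) :
  measurable_fun [set: R] f -> measurable_fun [set: lebesgueType R] f.
Proof.
move=> mf _ Y mY; apply: sub_caratheodory.
exact: (mf measurableT Y mY).
Qed.

Lemma integral_lebW (R : realType) (D : set R) (f : R -> \bar R) : D `<=` W ->
  (\int[lebW]_(x in D) f x = \int[leb]_(x in D) f x)%E.
Proof.
move=> DW; apply: eq_measure_integral => A _ AD.
by apply: lebWE; exact: subset_trans DW.
Qed.

(** The measure of the Borel sets is the image of the complete measure under the
identity map. *)
Lemma integral_leb_borel (R : realType) (D : set R) (f : R -> \bar R) :
  measurable D -> measurable_fun [set: R] f ->
  (\int[leb]_(x in D) f x = \int[lebesgue_measure]_(x in D) f x)%E.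
Proof.
move=> mD mf.
have mid : measurable_fun [set: lebesgueType R]
    (idfun : lebesgueType R -> measurableTypeR R).
  by apply: measurable_fun_borel; exact: measurable_id.
have push (h : R -> \bar R) : measurable_fun [set: R] h ->
    (forall x, 0 <= h x)%E ->
    (\int[leb]_(x in D) h x = \int[lebesgue_measure]_(x in D) h x)%E.
  move=> mh h0.
  have := @ge0_integral_pushforward _ _ _ _ _ _ mid leb D h mD
    (measurable_funTS mh) (fun x _ => h0 x).
  by move=> <-; apply: eq_measure_integral.
rewrite [LHS]integralE [RHS]integralE; congr (_ - _)%E.
- by apply: push; [exact: measurable_funepos|move=> x; exact: funepos_ge0].
- by apply: push; [exact: measurable_funeneg|move=> x; exact: funeneg_ge0].
Qed.

Lemma integrable_leb_borel (R : realType) (f : R -> \bar R) :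
  (@lebesgue_measure R).-integrable setT f ->
  (@leb R).-integrable [set: lebesgueType R] f.
Proof.
move=> /integrableP[mf foo]; apply/integrableP; split.
  exact: measurable_fun_borel.
rewrite (integral_leb_borel (D := setT))//.
exact: measurableT_comp.
Qed.

(** Differentiation and the Radon-Nikodym density are used for Borel functions; this
lemma is what carries the results over to Lebesgue measurable sets. *)
Lemma lebesgue_measurable_kernel (R : realType) (E : set R) :
  lebesgue_measurable E ->
  exists B : set R, [/\ measurable B, B `<=` E & leb (E `\` B) = 0%E].
Proof.
rewrite /lebesgue_measurable -completed_caratheodory_measurable.
rewrite g_sigma_completed_algebra_genE => -[B mB [N [A [mA A0 NA]] <-]].
exists B; split => //.
have mNB : lebesgue_measurable ((B `|` N) `\` B).
  apply: negligible_sub_caratheodory; exists A; split => //.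
    exact: sub_caratheodory.
  by move=> x [[Bx|/NA Ax] nBx].
apply/eqP; rewrite eq_le measure_ge0 andbT.
rewrite (_ : 0%E = leb A)//; apply: le_measure; rewrite ?inE//.
- exact: sub_caratheodory.
- by move=> x [[Bx|/NA Ax] nBx].
Qed.

(** * Differentiation along the dyadic intervals *)

(** A point x >= 0 of a dyadic interval of length r lies at a distance less than r
of all its points, so the ball of radius r around x contains the interval and
has twice its measure. The interval attached to x < 0 is an arbitrary choice:
the differentiation theorem requires a sequence at each real number. *)
Lemma dyadic_nicely_shrinking (R : realType) (x : R) :
  nicely_shrinking x (fun n => if 0 <= x then dyadic n (cell n x)
                               else `[x, x + 2 ^- n[%classic).
Proof.
have p0 n : (0 : R) < 2 ^- n by rewrite invr_gt0 exprn_gt0.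
split.
  by move=> n; case: ifPn => _; [exact: measurable_dyadic|exact: measurable_itv].
exists (2, fun n => PosNum (p0 n)); split => //=.
- under eq_fun do rewrite -exprVn.
  by apply: cvg_expr; rewrite ger0_norm ?invr_ge0// invf_lt1// ltr1n.
- move=> n; case: ifPn => [x0|_] y; last first.
    by rewrite /ball/= in_itv/= => /andP[xy yx]; rewrite ltr_norml; lra.
  have /= : dyadic n (cell n x) x by apply/dyadicP.
  have e : (cell n x).+1%:R / 2 ^+ n = (cell n x)%:R / 2 ^+ n + 2 ^- n :> R.
    by rewrite -[in LHS]natr1 mulrDl mul1r.
  rewrite /dyadic/= !in_itv/= e => xj yj.
  by rewrite /ball/= ltr_norml; lra.
- move=> n; rewrite lebesgue_measure_ball ?(ltW (p0 n))//.
  case: ifPn => _.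
    by rewrite -leb_borel leb_dyadic -EFinM mulr_natl.
  by rewrite lebesgue_measure_itv/= lte_fin ltrDl p0 -EFinD addrAC subrr add0r
    -EFinM mulr_natl.
Qed.

Lemma ae_dyadic_derivative (R : realType) (f : R -> R) :
  locally_integrable setT f ->
  {ae @lebW R, forall x, 0 <= x -> 2 ^+ n *
     (\int[lebesgue_measure]_(y in dyadic n (cell n x)) f y)%R
     @[n --> \oo] --> f x}.
Proof.
move=> lf; apply: ae_lebW.
apply: (@filterS _ _ (ae_filter_ringOfSetsType _) _ _ _
  (lebesgue_differentiation lf)) => x fx x0.
have := nice_lebesgue_differentiation (@dyadic_nicely_shrinking R) lf fx.
move/fine_cvg => /=; rewrite x0; apply: cvg_trans; apply: near_eq_cvg.
apply: nearW => n /=; rewrite -leb_borel leb_dyadic.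
have p0 : (0 : R) < 2 ^+ n by rewrite exprn_gt0.
rewrite inver invr_eq0 expf_eq0 pnatr_eq0 andbF invrK /Rintegral.
by case: (integral _ _ _) => [r| |]//=; rewrite ?mulr0 mulr_infty gtr0_sg ?mul1e.
Qed.

(** The density theorem for a Borel subset of E of full measure. *)
Lemma ae_average (R : realType) (E : set R) : lebesgue_measurable E ->
  {ae @lebW R, forall x, 0 <= x ->
    average E n (cell n x) @[n --> \oo] --> (\1_E x : R)}.
Proof.
move=> mE; have [B [mB BE EB0]] := lebesgue_measurable_kernel mE.
have mEB : measurable (E `\` B : set (lebesgueType R)).
  by apply: measurableD => //; exact: sub_caratheodory.
have aeEB : {ae @lebW R, forall x, \1_E x = \1_B x :> R}.
  exists (E `\` B); split => //.
    by apply/eqP; rewrite eq_le measure_ge0 andbT -EB0; exact: lebW_le_leb.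
  move=> x /= EBx; apply: contrapT => nEB; apply: EBx.
  rewrite !indicE; have [Bx|nBx] := pselect (B x).
    by rewrite !mem_set//; exact: BE.
  by rewrite !memNset// => Ex; apply: nEB.
have := ae_dyadic_derivative (locally_integrable_indic openT mB).
apply: (@filterS2 _ _ (ae_filter_ringOfSetsType _) _ _ _ _ aeEB) => x -> fx x0.
have := fx x0; apply: cvg_trans; apply: near_eq_cvg; apply: nearW => n.
rewrite /average leb_dyadic [fine (2 ^- n)%:E]/= invrK /Rintegral [RHS]mulrC.
congr (_ * _); congr fine.
rewrite integral_indic//; last exact: measurable_dyadic.
have mBD : measurable (B `&` dyadic n (cell n x) : set (lebesgueType R)).
  by apply: sub_caratheodory; apply: measurableI => //; exact: measurable_dyadic.
have mED : measurable (E `&` dyadic n (cell n x) : set (lebesgueType R)).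
  by apply: measurableI => //; exact: lebesgue_measurable_dyadic.
change (leb (B `&` dyadic n (cell n x)) = leb (E `&` dyadic n (cell n x))).
apply/eqP; rewrite eq_le; apply/andP; split.
  by apply: le_measure; rewrite ?inE//; exact: setSI.
rewrite -[leRHS]adde0 -EB0; apply: le_trans (measureU2 _ _ _) => //.
apply: le_measure; rewrite ?inE//; first exact: measurableU.
by move=> y [Ey Dy]; have [By|nBy] := pselect (B y); [left|right].
Qed.

Lemma indic_sub_average_le1 (R : realType) (E : set R) n x :
  lebesgue_measurable E ->
  `|\1_E x - dyadic_fun n (average E n) x| <= 1.
Proof.
move=> mE; have [b0 b1] : 0 <= \1_E x :> R /\ \1_E x <= 1 :> R.
  by rewrite indicE; case: (_ \in _) => /=; rewrite ?ler01 ?lexx.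
have [a0 a1] : 0 <= dyadic_fun n (average E n) x /\
               dyadic_fun n (average E n) x <= 1.
  rewrite /dyadic_fun; case: ifPn => _; last by rewrite lexx ler01.
  by rewrite average_ge0 average_le1.
by rewrite ler_norml; lra.
Qed.

(** Dominated convergence applies since the functions are bounded by 1 on a space of
finite measure. *)
Lemma average_cvg_L2 (R : realType) (E : set R) : lebesgue_measurable E ->
  L2norm (\1_E \- dyadic_fun n (average E n)) @[n --> \oo] --> 0%E.
Proof.
move=> mE; pose f n x := (\1_E x - dyadic_fun n (average E n) x) ^+ 2.
have mf n : measurable_fun [set: lebesgueType R] (f n).
  apply: measurable_funX; apply: measurable_funB.
    exact: measurable_fun_indic_lebesgue.
  exact: measurable_dyadic_fun.
have f1 n x : (`|(f n x)%:E| <= 1)%E.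
  rewrite abse_EFin lee_fin /f normrX expr_le1//.
  exact: indic_sub_average_le1.
have intf n : (@lebW R).-integrable [set: lebesgueType R] (EFin \o f n).
  apply: (@le_integrable _ (lebesgueType R) R lebW setT measurableT
    (EFin \o f n) (cst 1%E) _ _ (integrable_cst_lebW 1)).
    by apply/measurable_EFinP; exact: mf.
  by move=> x _; rewrite [leRHS]gee0_abs ?lee01//; exact: f1.
have [] := @dominated_convergence _ _ _ (@lebW R) setT measurableT
   (fun n => EFin \o f n) (cst 0%E) (cst 1%E).
- by move=> n; exact/measurable_EFinP.
- exact: measurable_cst.
- apply: (@filterS2 _ _ (ae_filter_ringOfSetsType _) _ _ _ _
    (ae_lebW_itv R) (ae_average mE)) => x /[dup] x01 /andP[x0 _] Ex _.
  change ((f n x)%:E @[n --> \oo] --> (0 : R)%:E).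
  apply: cvg_EFin; first exact: nearW.
  change (f n x @[n --> \oo] --> (0 : R)).
  have H : (\1_E x - average E n (cell n x)) @[n --> \oo] --> (0 : R).
    rewrite -(subrr (\1_E x)); apply: cvgB; first exact: cvg_cst.
    exact: Ex.
  have := cvgM H H; rewrite mulr0 => HH.
  rewrite (_ : (fun n => f n x) =
    (fun n => \1_E x - average E n (cell n x)) \*
    (fun n => \1_E x - average E n (cell n x))); first exact: HH.
  by apply/funext => n; rewrite /f/= /dyadic_fun x01 expr2.
- exact: (integrable_cst_lebW 1).
- by apply: aeW => x n _; exact: f1.
move=> _ _; rewrite integral0 => fcvg.
have ffin n : (\int[lebW]_x (f n x)%:E)%E \is a fin_num.
  exact: (integrable_fin_num measurableT (intf n)).
apply: (@L2norm_cvg0 _ _ (fun n => fine (\int[lebW]_x (f n x)%:E)%E)).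
- by move=> n; rewrite fine_ge0// integral_ge0// => x _; rewrite lee_fin sqr_ge0.
- by move=> n; rewrite fineK.
- exact: (fine_cvg fcvg).
Qed.

(** * The density of a Lebesgue extension *)

Section lebesgue_extension.
Context {R : realType} (g G : set R -> R).
Hypothesis Gext : lebesgue_extension g G.

Lemma lebesgue_extension_null A : lebesgue_measurable A -> A `<=` W ->
  leb A = 0%E -> G A = 0.
Proof.
move=> mA AW A0; apply/eqP; rewrite -normr_le0 leNgt; apply/negP => GA.
have [_ _ /(_ _ GA)[d d0 /(_ _ mA AW)]] := Gext.
by rewrite A0 lte_fin ltxx => /(_ d0).
Qed.

Lemma lebesgue_extension_set0 : G set0 = 0.
Proof.
apply: lebesgue_extension_null; rewrite ?measure0//.
exact: measurable0.
Qed.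

Lemma lebesgue_extensionU A B : lebesgue_measurable A -> A `<=` W ->
  lebesgue_measurable B -> B `<=` W -> A `&` B = set0 ->
  G (A `|` B) = G A + G B.
Proof.
move=> mA AW mB BW AB; have [_ Gsigma _] := Gext.
have := Gsigma (bigcup2 A B).
rewrite bigcup2E -trivIset_bigcup2 => /(_ _ AB) H.
have {}H : \sum_(0 <= i < n) G (bigcup2 A B i) @[n --> \oo] --> G (A `|` B).
  apply: H => -[|[|i]]; split => //=.
  exact: measurable0.
suff H' : \sum_(0 <= i < n) G (bigcup2 A B i) @[n --> \oo] --> G A + G B.
  by rewrite -(cvg_lim _ H)// (cvg_lim _ H').
rewrite -(cvg_shiftn 2)/= (_ : (fun n => _) = cst (G A + G B)).
  exact: cvg_cst.
apply/funext => n /=; rewrite addn2 big_nat_recl// big_nat_recl//=.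
rewrite big1_seq ?addr0// => i _; rewrite /bigcup2/=.
exact: lebesgue_extension_set0.
Qed.

(** The values of G are meaningful on subsets of W only. *)
Let nu (A : set (measurableTypeR R)) : \bar R := (G (A `&` W))%:E.

Let nu0 : nu set0 = 0%E.
Proof. by rewrite /nu set0I lebesgue_extension_set0. Qed.

Let nu_fin A : measurable A -> nu A \is a fin_num.
Proof. by []. Qed.

Let nu_sigma : semi_sigma_additive nu.
Proof.
move=> F mF tF _; rewrite /nu setI_bigcupl.
under eq_fun do rewrite sumEFin.
apply: cvg_EFin; first exact: nearW.
have [_ + _] := Gext; apply.
- move=> i; split; last exact: subIsetr.
  by apply: measurableI; [exact: sub_caratheodory|exact: lebesgue_measurable_W].
- exact: trivIset_setIr.
Qed.

HB.instance Definition _ := isCharge.Build _ _ _ nu nu0 nu_fin nu_sigma.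

Let nu_dominated : nu `<< @lebesgue_measure R.
Proof.
move=> N N0 A mA AN; rewrite /nu lebesgue_extension_null//.
  by apply: measurableI; [exact: sub_caratheodory|exact: lebesgue_measurable_W].
change (lebW A = 0%E).
apply/eqP; rewrite eq_le measure_ge0 andbT -(N0 A mA AN).
by apply: lebW_le_leb; exact: sub_caratheodory.
Qed.

(** Radon-Nikodym for G as a charge on the Borel sets, then Lebesgue differentiation
of its density: the integral of h over a dyadic interval is the value of g
there. *)
Lemma lebesgue_extension_derivative : exists h : R -> R,
  [/\ measurable_fun setT h,
      (@leb R).-integrable [set: lebesgueType R] (EFin \o h),
      forall E, lebesgue_measurable E -> E `<=` W ->
        G E = \int[leb]_(x in E) h x &
      {ae @lebW R, forall x, 0 <= x < 1 ->
        2 ^+ n * g (dyadic n (cell n x)) @[n --> \oo] --> h x}].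
Proof.
pose h x := fine (Radon_Nikodym nu (@lebesgue_measure R) x).
have hE x : (h x)%:E = Radon_Nikodym nu (@lebesgue_measure R) x.
  by rewrite fineK// Radon_Nikodym_fin_num.
have EFinh : EFin \o h = Radon_Nikodym nu (@lebesgue_measure R).
  by apply/funext => x; rewrite /= hE.
have inth : (@lebesgue_measure R).-integrable setT (EFin \o h).
  by rewrite EFinh; exact: Radon_Nikodym_integrable.
have mh : measurable_fun setT h.
  by apply/measurable_EFinP; case/integrableP : inth.
have intlebh := integrable_leb_borel inth.
have GB (B : set R) : measurable B -> B `<=` W ->
    (G B)%:E = (\int[lebesgue_measure]_(x in B) (h x)%:E)%E.
  move=> mB BW; under eq_integral do rewrite hE.
  by rewrite -Radon_Nikodym_integral//= /nu setIidl.
exists h; split => //.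
(* Both sides only depend on a Borel subset B of E of full measure. *)
- move=> E mE EW; have [B [mB BE EB0]] := lebesgue_measurable_kernel mE.
  have BW : B `<=` W by exact: subset_trans EW.
  have mB' : lebesgue_measurable B by exact: sub_caratheodory.
  have mEB : lebesgue_measurable (E `\` B) by exact: measurableD.
  have -> : G E = G B.
    rewrite -[in LHS](setDUK BE) lebesgue_extensionU//; last 2 first.
    + by move=> x [/EW].
    + exact: setDIK.
    by rewrite (lebesgue_extension_null mEB)// ?addr0// => x [/EW].
  apply: EFin_inj; rewrite GB//.
  have intE : (@leb R).-integrable E (EFin \o h).
    exact: (integrableS measurableT mE).
  rewrite /Rintegral fineK; last exact: (integrable_fin_num mE).
  rewrite (negligible_integral mEB mE intE EB0) setDD setIidr//.
  by rewrite integral_leb_borel//; exact/measurable_EFinP.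
- have lh : locally_integrable setT h.
    by apply: open_integrable_locally => //; exact: openT.
  apply: (@filterS _ _ (ae_filter_ringOfSetsType _) _ _ _
    (ae_dyadic_derivative lh)) => x hx x01.
  have /andP[x0 _] := x01.
  have := hx x0; rewrite (_ : (fun n => _) =
    (fun n => 2 ^+ n * g (dyadic n (cell n x))))//.
  apply/funext => n; congr (_ * _).
  have cn := cell_ltn n x01.
  have [/(_ n (Ordinal cn))/= <- _ _] := Gext.
  apply: EFin_inj; rewrite GB//; last exact: dyadic_subW.
    have mD : measurable (dyadic n (cell n x) : set (measurableTypeR R)).
      exact: measurable_dyadic.
    rewrite /Rintegral fineK//; apply: (integrable_fin_num mD).
    exact: (integrableS measurableT mD _ inth).
  exact: measurable_dyadic.
Qed.

End lebesgue_extension.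

(** * The density integral is a Lebesgue extension *)

(** A mean value of c(E; x) lies between 0 and 1, so its square is at most itself. *)
Lemma dyadic_norm2_average (R : realType) (E : set R) n :
  lebesgue_measurable E -> E `<=` W ->
  dyadic_norm2 n (average E n) <= fine (leb E).
Proof.
move=> mE EW.
have mED i : measurable (E `&` dyadic n i : set (lebesgueType R)).
  by apply: measurableI => //; exact: lebesgue_measurable_dyadic.
have Efin : leb E \is a fin_num.
  rewrite ge0_fin_numE ?measure_ge0// (@le_lt_trans _ _ (leb (@W R)))//.
    by apply: le_measure; rewrite ?inE//; exact: lebesgue_measurable_W.
  by rewrite leb_W ltry.
rewrite -lee_fin fineK//.
apply: (@le_trans _ _ (leb (\big[setU/set0]_(i < 2 ^ n) (E `&` dyadic n i)))).
  have tED : trivIset setT (fun i => E `&` dyadic n i).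
    by apply: trivIset_setIl; exact: trivIset_dyadic.
  have -> := @measure_bigsetU _ _ (lebesgueType R) leb _ mED tED (2 ^ n)%N.
  rewrite /dyadic_norm2 -sumEFin; apply: lee_sum => i _.
  have Ei : leb (E `&` dyadic n i) = (average E n i / 2 ^+ n)%:E.
    rewrite -[LHS](fineK (leb_setI_dyadic_fin n i mE)); congr EFin.
    rewrite /average leb_dyadic [fine (2 ^- n)%:E]/= invrK.
    by rewrite mulfK// expf_neq0.
  apply: (@le_trans _ _ (average E n i / 2 ^+ n)%:E); last by rewrite -Ei.
  rewrite lee_fin ler_pM2r ?invr_gt0 ?exprn_gt0// expr2.
  by rewrite ler_piMr ?average_ge0// average_le1.
apply: le_measure; rewrite ?inE//; first exact: bigsetU_measurable.
by rewrite -(bigcup_mkord _ (fun i => E `&` dyadic n i)) => x [i _ []].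
Qed.

Section density.
Context {R : realType} (K : set (set R)) (g : set R -> R).
Hypothesis KW : algebra_on W K.
Hypothesis Kmeas : forall A, K A -> lebesgue_measurable A.
Hypothesis KD : forall n (j : 'I_(2 ^ n)), K (dyadic n j).
Hypothesis gadd : additive_on K g.
Hypothesis Pc : P_continuous K g.

(** The step functions of mean values converge in L^2, so they form a Cauchy
sequence, and the bound on P turns it into a Cauchy sequence of values. *)
Lemma is_cvg_density_sum E : lebesgue_measurable E -> cvgn (density_sum g E).
Proof.
move=> mE; have [M M0 PM] := dyadic_sum_bound KD Pc.
have mF n : measurable_fun [set: lebesgueType R] (dyadic_fun n (average E n)).
  exact: measurable_dyadic_fun.
have m1 := measurable_fun_indic_lebesgue mE.
apply: cauchy_cvg; apply: cauchy_exP => e e0.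
pose d := e / (2 * (Num.sqrt M + 1)).
have sM0 : 0 <= Num.sqrt M by exact: sqrtr_ge0.
have d0 : 0 < d by rewrite divr_gt0// mulr_gt0// ltr_wpDl.
have [N _ HN] := near_lt_cvg0 d0 (average_cvg_L2 mE).
exists (density_sum g E N); exists N => // m /= Nm.
pose c j := average E N (j %/ 2 ^ (m - N))%N - average E m j.
have uc : density_sum g E N - density_sum g E m = dyadic_sum g m c.
  rewrite !density_sumE (refine_dyadic_sum KD Pc _ Nm) /dyadic_sum.
  by rewrite -sumrB; apply: eq_bigr => j _; rewrite mulrBl.
rewrite /ball/= uc.
(* The difference of two density sums is P of the difference of the two step
   functions, both of which are close to the indicator function of E. *)
have normc : Num.sqrt (dyadic_norm2 m c) < 2 * d.
  rewrite -lte_fin -L2norm_dyadic_fun -dyadic_funB -refine_dyadic_fun//.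
  apply: (le_lt_trans (L2norm_triangle (mF N) m1 (mF m))).
  rewrite mulr_natl mulr2n EFinD lteD//.
    by rewrite L2normB; apply: HN => /=.
  by apply: HN.
have := PM m c; rewrite -ler_sqrt ?mulr_ge0 ?dyadic_norm2_ge0//.
rewrite sqrtr_sqr => /le_lt_trans; apply.
rewrite sqrtrM// (@le_lt_trans _ _ (Num.sqrt M * (2 * d)))//.
  by rewrite ler_wpM2l// ltW.
rewrite (_ : 2 * d = e / (Num.sqrt M + 1)); last first.
  by rewrite /d invfM mulrCA (mulrA 2) divff// mul1r.
have s10 : 0 < Num.sqrt M + 1 by rewrite ltr_wpDl.
by rewrite mulrCA -[ltRHS]mulr1 ltr_pM2l// ltr_pdivrMr// mul1r ltrDl.
Qed.

Lemma density_integral_bound : exists2 M : R, 0 <= M &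
  forall E, lebesgue_measurable E -> E `<=` W ->
    `|density_integral g E| <= Num.sqrt (M * fine (leb E)).
Proof.
have [M M0 PM] := dyadic_sum_bound KD Pc; exists M => // E mE EW.
have cE := is_cvg_density_sum mE.
rewrite -(cvg_lim _ (cvg_norm cE))//; apply: limr_le.
  by apply/cvg_ex; exists `|density_integral g E|; exact: cvg_norm.
apply: nearW => n; rewrite density_sumE -sqrtr_sqr ler_sqrt; last first.
  by rewrite mulr_ge0// fine_ge0.
by rewrite (le_trans (PM _ _))// ler_wpM2l// dyadic_norm2_average.
Qed.

Lemma density_integralU A B : lebesgue_measurable A -> lebesgue_measurable B ->
  A `&` B = set0 ->
  density_integral g (A `|` B) = density_integral g A + density_integral g B.
Proof.
move=> mA mB AB; rewrite /density_integral.
rewrite (_ : density_sum g (A `|` B) = density_sum g A + density_sum g B).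
  by apply: limD; exact: is_cvg_density_sum.
apply/funext => n.
change (density_sum g (A `|` B) n = density_sum g A n + density_sum g B n).
rewrite !density_sumE /dyadic_sum -big_split/=; apply: eq_bigr => j _.
rewrite -mulrDl /average -mulrDl; congr (_ / _ * _).
have mAj := leb_setI_dyadic_fin n j mA.
have mBj := leb_setI_dyadic_fin n j mB.
rewrite -fineD// setIUl measureU//.
- by apply: measurableI => //; exact: lebesgue_measurable_dyadic.
- by apply: measurableI => //; exact: lebesgue_measurable_dyadic.
- by rewrite setIACA AB set0I.
Qed.

Lemma density_integral_set0 : density_integral g set0 = 0.
Proof.
rewrite /density_integral (_ : density_sum g set0 = cst 0) ?lim_cst//.
apply/funext => n; rewrite /density_sum big1// => j _.
by rewrite set0I measure0 mulr0 mul0r.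
Qed.

(** The mean values of c(A; x) approximate it in norm, and here c(A; x) is itself in
the domain of P. The empty set is apart, as it cannot occur in a step. *)
Lemma density_integralK A : K A -> density_integral g A = g A.
Proof.
move=> KA; have [_ _ [K0 _ _]] := KW.
have [A0|/set0P A0] := eqVneq A set0.
  rewrite A0 density_integral_set0; apply: (addrI (g set0)).
  by rewrite addr0 gadd// ?setU0// set0I.
pose s := @Step R K 0 (fun=> 1) (fun=> A) (fun=> KA) (fun=> A0)
  (fun i j _ _ _ => etrans (ord1 i) (esym (ord1 j))).
have sA : step_fun s = \1_A.
  by apply/funext => x; rewrite /step_fun big_ord1 mul1r.
have PsA : P g s = g A by rewrite /P big_ord1 mul1r.
rewrite -PsA; apply/cvg_lim => //.
rewrite (_ : density_sum g A =
    (fun n => P g (dyadic_step KD n (average A n)))); last first.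
  by apply/funext => n; rewrite P_dyadic density_sumE.
apply: Pc; rewrite sA; under eq_fun do rewrite step_fun_dyadic.
exact: average_cvg_L2 (Kmeas KA).
Qed.

(** Finite additivity reduces this to the remainders, which decrease to the empty
set; their measures tend to 0, and the bound in terms of the measure applies. *)
Lemma density_integral_sigma_additive (F : nat -> set R) :
  (forall i, lebesgue_measurable (F i) /\ F i `<=` W) ->
  trivIset [set: nat] F ->
  \sum_(0 <= i < n) density_integral g (F i) @[n --> \oo] -->
  density_integral g (\bigcup_i F i).
Proof.
move=> FW tF; have [M M0 GM] := density_integral_bound.
pose S n := \big[setU/set0]_(i < n) F i.
pose T n := \bigcup_i F i `\` S n.
have mF i : measurable (F i : set (lebesgueType R)) by exact: (FW i).1.
have mU : measurable (\bigcup_i F i : set (lebesgueType R)).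
  exact: bigcupT_measurable.
have mS n : measurable (S n : set (lebesgueType R)).
  exact: bigsetU_measurable.
have mT n : measurable (T n : set (lebesgueType R)) by exact: measurableD.
have UW : \bigcup_i F i `<=` W by apply: bigcup_sub => i _; exact: (FW i).2.
have TW n : T n `<=` W by move=> x [/UW].
have SU n : S n `<=` \bigcup_i F i.
  by rewrite /S -bigcup_mkord => x [i _ Fi]; exists i.
have GS n : density_integral g (S n) = \sum_(0 <= i < n) density_integral g (F i).
  elim: n => [|n IH].
    by rewrite /S big_ord0 big_geq// density_integral_set0.
  rewrite big_nat_recr//= -IH /S big_ord_recr/= density_integralU//.
    exact: mS.
    exact: mF.
  apply/seteqP; split => // x; rewrite -bigcup_mkord => -[[i /= ilt Fi] Fn].
  have ij : i = n by apply: tF => //; exists x.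
  by rewrite ij ltnn in ilt.
have GU n : density_integral g (\bigcup_i F i) -
    \sum_(0 <= i < n) density_integral g (F i) = density_integral g (T n).
  have ST : S n `|` T n = \bigcup_i F i by rewrite setDUK.
  have := density_integralU (mS n) (mT n) (setDIK _ _).
  by rewrite ST GS => ->; rewrite addrAC subrr add0r.
have T0 : leb (T n) @[n --> \oo] --> 0%E.
  have -> : 0%E = leb (\bigcap_n T n).
    rewrite (_ : \bigcap_n T n = set0) ?measure0//.
    apply/seteqP; split => // x TX; have [[i _ Fix] _] := TX 0%N I.
    have [_] := TX i.+1 I; apply; rewrite /S -bigcup_mkord.
    by exists i => /=.
  apply: nonincreasing_cvg_mu => //.
  - apply: (@le_lt_trans _ _ (leb (@W R))); last by rewrite leb_W ltry.
    apply: le_measure; rewrite ?inE//; exact: lebesgue_measurable_W.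
  - exact: bigcapT_measurable.
  - move=> n m nm; apply/subsetPset; apply: setDS; rewrite /S.
    rewrite -(bigcup_mkord n) -(bigcup_mkord m) => x [i /= im Fi].
    by exists i => //=; exact: leq_trans im nm.
have {}T0 : Num.sqrt (M * fine (leb (T n))) @[n --> \oo] --> (0 : R).
  rewrite -(sqrtr0 R); apply: continuous_cvg; first exact: sqrt_continuous.
  rewrite -(mulr0 M); apply: cvgM; first exact: cvg_cst.
  exact: (fine_cvg T0).
apply/cvgrPdist_lt => e e0; have [N _ HN] := cvgr_lt _ T0 _ e0.
exists N => // n /= Nn; rewrite GU; apply: le_lt_trans (HN n Nn).
exact: (GM _ (mT n) (@TW n)).
Qed.

Lemma lebesgue_extension_density_integral :
  lebesgue_extension g (density_integral g).
Proof.
split.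
- by move=> n j; apply: density_integralK; exact: KD.
- exact: density_integral_sigma_additive.
- move=> e e0; have [M M0 GM] := density_integral_bound.
  have d0 : 0 < e ^+ 2 / (M + 1).
    by rewrite divr_gt0 ?exprn_gt0// ltr_wpDl.
  exists (e ^+ 2 / (M + 1)) => // A mA AW Ad.
  rewrite (le_lt_trans (GM A mA AW))//.
  have Afin : leb A \is a fin_num.
    by rewrite ge0_fin_numE ?measure_ge0// (lt_trans Ad) ?ltry.
  move: Ad; rewrite -(fineK Afin) lte_fin ltr_pdivlMr ?ltr_wpDl// => Ad.
  have A0 : 0 <= fine (leb A) by rewrite fine_ge0.
  rewrite -[ltRHS](gtr0_norm e0) -sqrtr_sqr ltr_sqrt ?exprn_gt0//.
  by rewrite (le_lt_trans _ Ad)// mulrC ler_wpM2l// lerDl.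
Qed.

End density.

(** * The extension of P to L^2(0,1) *)

(** Fatou's lemma when the limit exists only almost everywhere. *)
Lemma ae_fatou_le d (T : measurableType d) (R : realType)
    (mu : {measure set T -> \bar R}) (f_ : nat -> T -> \bar R) (f : T -> \bar R)
    (M : \bar R) :
  (forall n, measurable_fun setT (f_ n)) -> (forall n x, (0 <= f_ n x)%E) ->
  measurable_fun setT f ->
  {ae mu, forall x, f_ n x @[n --> \oo] --> f x} ->
  (forall n, (\int[mu]_x f_ n x <= M)%E) -> (\int[mu]_x f x <= M)%E.
Proof.
move=> mf_ f0 mf cf fM.
have mlim : measurable_fun setT (fun x => limn_einf (f_^~ x)).
  rewrite (_ : (fun x => _) =
      (fun x => - limn_esup ((fun n y => - f_ n y)^~ x))%E).
    apply: measurableT_comp => //; apply: measurable_fun_limn_esup => n.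
    exact: measurableT_comp.
  apply/funext => x; have := limn_esupN (f_^~ x).
  by rewrite /comp => ->; rewrite oppeK.
have -> : (\int[mu]_x f x = \int[mu]_x limn_einf (f_^~ x))%E.
  apply: ae_eq_integral => //.
  apply: (@filterS _ _ (ae_filter_ringOfSetsType _) _ _ _ cf) => x fx _.
  by rewrite (cvg_limn_einf_sup fx).1.
apply: (le_trans (fatou mu measurableT mf_ (fun n x _ => f0 n x))).
rewrite limn_einf_lim; apply: lime_le; first exact: is_cvg_einfs.
apply: nearW => n; apply: le_trans (fM n).
by apply: ereal_inf_lbound; exists n => /=.
Qed.

(** The derivative is the limit of the step functions g(I) / m(I), whose norms are
bounded. *)
Lemma derivative_L2 (R : realType) (K : set (set R)) (g : set R -> R)
    (h : R -> R) :
  (forall n (j : 'I_(2 ^ n)), K (dyadic n j)) -> P_continuous K g ->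
  measurable_fun [set: lebesgueType R] h ->
  {ae @lebW R, forall x, 0 <= x < 1 ->
     2 ^+ n * g (dyadic n (cell n x)) @[n --> \oo] --> h x} ->
  h \in L2.
Proof.
move=> KD Pc mh hx; have [M M0 PM] := dyadic_sum_bound KD Pc.
pose c n j : R := 2 ^+ n * g (dyadic n j).
(* The value S of P at this step function is also its squared norm, so the bound
   S ^ 2 <= M * S gives S <= M. *)
have normc n : dyadic_norm2 n (c n) = dyadic_sum g n (c n).
  apply: eq_bigr => j _; rewrite /c expr2 -!mulrA; congr (_ * _).
  by congr (_ * _); rewrite mulrCA divff ?mulr1// expf_neq0.
have normM n : dyadic_norm2 n (c n) <= M.
  have := PM n (c n); rewrite -normc expr2.
  have := dyadic_norm2_ge0 n (c n); rewrite le_eqVlt => /predU1P[<-//|c0].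
  by rewrite ler_pM2r.
have mh2 : measurable_fun [set: lebesgueType R] (fun x => (h x ^+ 2)%:E).
  by apply/measurable_EFinP; exact: measurable_funX.
have hM : (\int[lebW]_x (h x ^+ 2)%:E <= M%:E)%E.
  apply: (@ae_fatou_le _ (lebesgueType R) R lebW
    (fun n x => (dyadic_fun n (c n) x ^+ 2)%:E)
    (fun x => (h x ^+ 2)%:E) M%:E _ _ mh2).
  - move=> n; apply/measurable_EFinP; apply: measurable_funX.
    exact: measurable_dyadic_fun.
  - by move=> n x; rewrite lee_fin sqr_ge0.
  - apply: (@filterS2 _ _ (ae_filter_ringOfSetsType _) _ _ _ _
      (ae_lebW_itv R) hx) => x x01 /(_ x01) cx.
    apply: cvg_EFin; first exact: nearW.
    rewrite (_ : fine \o _ = (fun n => c n (cell n x)) \*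
                             (fun n => c n (cell n x))).
      by rewrite expr2; exact: cvgM.
    by apply/funext => n /=; rewrite /dyadic_fun x01 expr2.
  - by move=> n; rewrite integral_dyadic_fun_sqr lee_fin normM.
have h0 : (0 <= \int[lebW]_x (h x ^+ 2)%:E)%E.
  by apply: integral_ge0 => x _; rewrite lee_fin sqr_ge0.
have hfin : (\int[lebW]_x (h x ^+ 2)%:E)%E \is a fin_num.
  by rewrite ge0_fin_numE// (le_lt_trans hM)// ltry.
apply/andP; split; first by rewrite inE.
rewrite inE /=/finite_norm.
have := @L2normE R h _ (fine_ge0 h0); rewrite fineK// => /(_ erefl).
by rewrite /L2norm => ->; rewrite ltry.
Qed.

Section hoelder_functional.
Context {R : realType} (h : R -> R).
Hypothesis hL2 : h \in L2.

Definition inner (f : R -> R) : R := \int[lebW]_x (f x * h x).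

Lemma measurable_L2 (f : R -> R) : f \in L2 ->
  measurable_fun [set: lebesgueType R] f.
Proof. by rewrite inE => /andP[]; rewrite inE. Qed.

Lemma integrable_L2M (f : R -> R) : f \in L2 ->
  (@lebW R).-integrable [set: lebesgueType R] (fun x => (f x * h x)%:E).
Proof.
move=> fL2.
have := @Lfun2_mul_Lfun1 _ (lebesgueType R) R lebW f h fL2 hL2.
by move=> /Lfun1_integrable.
Qed.

(** The inequality of Hoelder. *)
Lemma inner_continuous (f_ : nat -> R -> R) (f : R -> R) :
  (forall n, f_ n \in L2) -> f \in L2 ->
  L2norm (f \- f_ n) @[n --> \oo] --> 0%E ->
  inner (f_ n) @[n --> \oo] --> inner f.
Proof.
move=> f_L2 fL2 cf.
have hfin : L2norm h \is a fin_num.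
  rewrite ge0_fin_numE ?Lnorm_ge0//.
  by move: hL2; rewrite inE => /andP[_]; rewrite inE.
pose C := fine (L2norm h).
have C0 : 0 <= C by rewrite fine_ge0// Lnorm_ge0.
apply/cvgrPdist_lt => e e0.
have d0 : 0 < e / (C + 1) by rewrite divr_gt0// ltr_wpDl.
have [N _ HN] := near_lt_cvg0 d0 cf.
exists N => // n /HN fn.
have m1 := measurable_L2 fL2; have m2 := measurable_L2 (f_L2 n).
have mfh := measurable_L2 hL2.
have i1 := integrable_L2M fL2; have i2 := integrable_L2M (f_L2 n).
rewrite /inner -RintegralB//.
have i12 : (@lebW R).-integrable [set: lebesgueType R]
    (fun x => (f x * h x - f_ n x * h x)%:E).
  by under eq_fun do rewrite EFinB; exact: integrableB.
apply: (le_lt_trans (le_normr_Rintegral measurableT i12)).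
have two0 : 0 < 2 :> R by rewrite ltr0n.
have half : 2^-1 + 2^-1 = 1 :> R by rewrite [RHS]splitr !div1r.
have ho := @hoelder _ (lebesgueType R) R lebW (f \- f_ n) h 2 2
  (measurable_funB m1 m2) mfh two0 two0 half.
rewrite -lte_fin /Rintegral fineK; last first.
  apply: (integrable_fin_num measurableT).
  exact: (integrable_norm i12).
apply: (@le_lt_trans _ _ (L2norm (f \- f_ n)%R * C%:E)%E).
  move: ho; rewrite Lnorm1 fineK//; apply: le_trans.
  by rewrite le_eqVlt; apply/orP; left; apply/eqP; apply: eq_integral => x _;
    rewrite /= mulrBl.
apply: (@le_lt_trans _ _ ((e / (C + 1))%:E * C%:E)%E).
  by apply: lee_wpmul2r; [rewrite lee_fin|exact: ltW].
rewrite -EFinM lte_fin -mulrA gtr_pMr// mulrC ltr_pdivrMr ?mul1r ?ltrDl//.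
by rewrite ltr_wpDl.
Qed.

Lemma inner_indic (E : set R) : lebesgue_measurable E -> E `<=` W ->
  inner \1_E = \int[leb]_(x in E) h x.
Proof.
move=> mE EW; transitivity (\int[@lebW R]_(x in E) h x).
  rewrite Rintegral_mkcond; apply: eq_Rintegral => x _.
  by rewrite patch_indic /= mulrC.
by rewrite /Rintegral integral_lebW.
Qed.

Lemma inner_sum n (c : 'I_n -> R) (E : 'I_n -> set R) :
  (forall i, lebesgue_measurable (E i)) ->
  inner (fun x => \sum_i c i * \1_(E i) x) = \sum_i c i * inner \1_(E i).
Proof.
move=> mE; have intE i := integrable_L2M (indic_L2 (mE i)).
apply: EFin_inj; rewrite -sumEFin.
have intcE i : (@lebW R).-integrable [set: lebesgueType R]
    (fun x => (c i * (\1_(E i) x * h x))%:E).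
  by under eq_fun do rewrite EFinM; exact: integrableZl.
transitivity (\int[@lebW R]_x \sum_i (c i * (\1_(E i) x * h x))%:E)%E.
  transitivity (\int[@lebW R]_x ((\sum_i c i * \1_(E i) x) * h x)%:E)%E.
    rewrite /inner /Rintegral fineK//; apply: (integrable_fin_num measurableT).
    under eq_fun do rewrite mulr_suml -sumEFin.
    apply: integrable_sum => // i _.
    by under eq_fun do rewrite -mulrA; exact: intcE.
  apply: eq_integral => x _; rewrite mulr_suml -sumEFin.
  by apply: eq_bigr => i _; rewrite mulrA.
rewrite integral_sum//; apply: eq_bigr => i _.
rewrite -[LHS]fineK; last exact: (integrable_fin_num measurableT).
congr EFin.
exact: (@RintegralZl _ _ _ (@lebW R) setT (fun x => \1_(E i) x * h x) (c i)
  measurableT (intE i)).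
Qed.

End hoelder_functional.

(** * The theorem *)

Theorem mainTheorem20 (R : realType) (K : set (set R)) (g : set R -> R) :
  algebra_on W K ->
  (forall A, K A -> lebesgue_measurable A) ->
  (forall n (j : 'I_(2 ^ n)), K (dyadic n j)) ->
  additive_on K g ->
  P_continuous K g ->
  [/\ (exists Q, L2_extension K g Q),
      (exists G, lebesgue_extension g G /\
        exists dg : R -> R,
          [/\ ae_derivative g dg,
              (@leb R).-integrable W (EFin \o dg) &
              forall E, lebesgue_measurable E -> E `<=` W ->
                G E = \int[leb]_(x in E) dg x]) &
      forall Q G, L2_extension K g Q -> lebesgue_extension g G ->
        forall E, lebesgue_measurable E -> E `<=` W ->
          [/\ cvgn (density_sum g E),
              Q \1_E = density_integral g E &
              density_integral g E = G E]].
Proof.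
move=> KW Kmeas KD gadd Pc.
have ext := lebesgue_extension_density_integral KW Kmeas KD gadd Pc.
have [h [mh inth Gh hx]] := lebesgue_extension_derivative ext.
have mhL := measurable_fun_borel mh.
have hL2 := derivative_L2 KD Pc mhL hx.
have [KsubW _ _] := KW.
split.
- exists (inner h); split; last exact: inner_continuous.
  move=> s; rewrite /step_fun inner_sum//; last first.
    by move=> i; apply: Kmeas; exact: step_setK.
  apply: eq_bigr => i _; have Ki := step_setK i.
  rewrite inner_indic; [|exact: Kmeas|exact: KsubW].
  rewrite -Gh; [|exact: Kmeas|exact: KsubW].
  by rewrite (density_integralK KW Kmeas KD gadd Pc).
- exists (density_integral g); split => //; exists h; split => //.
  + apply: (@filterS _ _ (ae_filter_ringOfSetsType _) _ _ _ hx) => x hx' j jx.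
    have x01 := dyadic_ge0_lt1 (ltn_ord (j 0%N)) (jx 0%N).
    have := hx' x01; rewrite (_ : (fun n => _) = (fun n =>
      g (dyadic n (j n)) / fine (leb (dyadic n (j n)))))//.
    apply/funext => n; rewrite leb_dyadic invrK mulrC.
    by have [_ ->] := (dyadicP n (j n) x).1 (jx n).
  + apply: (integrableS measurableT _ _ inth) => //.
    exact: lebesgue_measurable_W.
- move=> Q G [QP Qc] Gext E mE EW.
  have cE := is_cvg_density_sum KD Pc mE.
  split => //.
  + apply/esym/cvg_lim => //.
    have -> : density_sum g E = (fun n => Q (dyadic_fun n (average E n))).
      apply/funext => n; rewrite density_sumE -(P_dyadic g KD) -QP.
      by rewrite step_fun_dyadic.
    apply: Qc; [by move=> n; exact: dyadic_fun_L2|exact: indic_L2|].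
    exact: average_cvg_L2.
  + have [h' [mh' _ Gh' hx']] := lebesgue_extension_derivative Gext.
    rewrite Gh// Gh'// /Rintegral -!integral_lebW//; congr fine.
    (* The two densities are derivatives of the same g. *)
    have ae2 : {ae @lebW R, forall x, 0 <= x < 1 -> h x = h' x}.
      apply: (@filterS2 _ _ (ae_filter_ringOfSetsType _) _ _ _ _ hx hx').
      move=> x c1 c2 x01; have {}c1 := c1 x01; have {}c2 := c2 x01.
      by rewrite -(cvg_lim _ c1)// -(cvg_lim _ c2).
    have mhE (k : R -> R) : measurable_fun setT k ->
        measurable_fun (E : set (lebesgueType R)) (EFin \o k).
      move=> mk; apply/measurable_EFinP; apply: measurable_funTS.
      exact: measurable_fun_borel.
    apply: (@ae_eq_integral _ (lebesgueType R) R lebW E (EFin \o h')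
      (EFin \o h) mE (mhE _ mh) (mhE _ mh')).
    apply: (@filterS2 _ _ (ae_filter_ringOfSetsType _) _ _ _ _ ae2
      (ae_lebW_itv R)) => x hh x01 _.
    by rewrite /= hh.
Qed.
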